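(* Let $v\in\{1,2\}^*$ have $d$ descents and write $$v=1^{m_0}2^{n_0}1^{m_1}2^{n_1}\cdots1^{m_d}2^{n_d}$$ with $m_0,n_d\ge0$ and $m_i,n_j>0$ for all other $i,j$. Let $B_n$ be the set of ballot sequences in $\Pi(1^n2^n)$. Then $\phi(v)\in B_n$ (with $\phi$ Foata's fundamental bijection) if and only if both of the following conditions hold: (i) for all $i$ with $1\le i\le d$, $$m_d+m_{d-1}+\cdots+m_{d-i+1}\ge 2i,\qquad n_d+n_{d-1}+\cdots+n_{d-i+1}\ge 2i-1;$$ (ii) $$\sum_{i=0}^d m_i=\sum_{i=0}^d n_i=n.$$
   Context: $\mathbb P^*$ is the set of all finite words in the positive integers. For a word $w$, $\Pi(w)$ is the set of all rearrangements of $w$; $a^m$ denotes $m$ copies of the letter $a$. A descent of $a_1\ldots a_n$ is an index $i<n$ with $a_i>a_{i+1}$. A word $w\in\{1,2\}^*$ is a ballot sequence if every prefix of $w$ contains at least as many ones as twos. Every $v\in\{1,2\}^*$ with exactly $d$ descents has a unique expression of the displayed form. Foata's fundamental bijection $\phi:\mathbb P^*\to\mathbb P^*$: $\phi(\epsilon)=\epsilon$ for the empty word $\epsilon$. For $v=a_1\ldots a_n$ with $n\ge1$, define $w_1=a_1$ and, given $w_i=b_1\ldots b_i$, define $w_{i+1}$ as follows. If $b_i\le a_{i+1}$ (respectively $b_i>a_{i+1}$), factor $w_i=f_1f_2\cdots f_k$ uniquely so that in each factor every letter is $>a_{i+1}$ (respectively $\le a_{i+1}$) except its last letter, which is $\le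 a_{i+1}$ (respectively $>a_{i+1}$). Let $g_j$ be obtained from $f_j$ by moving its last letter to the front, and set $w_{i+1}=g_1g_2\cdots g_k\,a_{i+1}$. Then $\phi(v)=w_n$. The map $\phi$ is a bijection preserving the multiset of letters. *)

(* Defs.v *)
From mathcomp Require Import all_boot.

Set Implicit Arguments.
Unset Strict Implicit.
Unset Printing Implicit Defensive.

(* Words are of type seq nat; none of the definitions depends on the letters
   being positive. *)

Definition word12 (w : seq nat) : bool := all (pred2 1 2) w.

(* Positions are counted from 0, so i ranges over 0, ..., size w - 2. *)
Definition descents (w : seq nat) : nat :=
  count (fun i => nth 0 w i > nth 0 w i.+1) (iota 0 (size w).-1).

Definition ballot (w : seq nat) : Prop :=
  word12 w /\ forall u, prefix u w -> count_mem 2 u <= count_mem 1 u.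

Definition in_B (n : nat) (w : seq nat) : Prop :=
  ballot w /\ perm_eq w (nseq n 1 ++ nseq n 2).

(* A factor whose last letter satisfies p and whose other letters do not. *)
Definition marked_factor (p : pred nat) (f : seq nat) : bool :=
  if f is x :: s then p (last x s) && ~~ has p (belast x s) else false.

(* Cuts w after each letter satisfying p. If the last letter of w satisfies p,
   as it always does in foata_step, this is the unique factorization of w into
   marked factors; see the three lemmas below. *)
Fixpoint factorize (p : pred nat) (w : seq nat) : seq (seq nat) :=
  if w is x :: w' then
    if p x then [:: x] :: factorize p w'
    else if factorize p w' is f :: fs then (x :: f) :: fs else [:: [:: x]]
  else [::].

Lemma flatten_factorize (p : pred nat) w : flatten (factorize p w) = w.
Proof.
elim: w => //= x w IHw; case: ifP => _ /=; first by rewrite IHw.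
by case: (factorize p w) IHw => [|f fs] /= <-.
Qed.

Lemma factorize_marked (p : pred nat) x w :
  p (last x w) -> all (marked_factor p) (factorize p (x :: w)).
Proof.
elim: w x => [|y w IHw] x px; first by move: px => /= px; rewrite px /= px.
have := IHw y px; have := flatten_factorize p (y :: w).
rewrite [factorize p [:: x, y & w]]/=.
rewrite -[if p y then _ else _]/(factorize p (y :: w)).
case: (factorize p (y :: w)) => [//|[|z f] fs] //= _.
case/andP=> /andP[pl nh] Hfs.
by case px': (p x) => /=; rewrite pl px' nh Hfs.
Qed.

Lemma factorize_unique (p : pred nat) fs :
  all (marked_factor p) fs -> factorize p (flatten fs) = fs.
Proof.
elim: fs => //= -[|x f] //= fs IHfs /andP[/andP[pl nh] /IHfs].
elim: f x pl nh => [|y f IHf] x /= pl nh E; first by rewrite pl E.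
move: nh; rewrite negb_or => /andP[/negbTE-> nh].
by have /= -> := IHf y pl nh E.
Qed.

(* rotr 1 moves the last letter of a factor to its front. For w = [::] the
   result is [:: a], which gives the initial word w_1 = a_1. *)
Definition foata_step (w : seq nat) (a : nat) : seq nat :=
  let p : pred nat :=
    if last a w <= a then (fun x => x <= a) else (fun x => x > a) in
  rcons (flatten [seq rotr 1 f | f <- factorize p w]) a.

Definition foata (v : seq nat) : seq nat := foldl foata_step [::] v.

(* Main.v *)
Require Import Defs.
From mathcomp Require Import all_boot zify.

(** On words in 1 and 2 the map [foata] has a closed form.  When a 2 is added,
    every factor is a single letter and the 2 is just appended ([foata_step2]).
    When a 1 is added, all factors end in the same letter, so rotating each of
    them amounts to rotating the whole word: the last letter goes to the front
    before the 1 is appended ([foata_step1]).  Hence, when a block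
    1^(m_i) 2^(k_i) with i > 0 is read, the last 2 of the current word goes to
    the front, m_i - 1 ones are put before it, and a 1 and then 2^(k_i) are
    appended.  For d > 0 this gives ([foata_blocks])
      1^(m_d - 1) 2 ... 1^(m_1 - 1) 2 1^(m_0) .
           2^(k_0 - 1) 1 ... 2^(k_(d-1) - 1) 1 2^(k_d).
    Both halves are staircases [stair]; the second one is read backwards with
    the letters exchanged ([mirror]).

    When there are as many ones as twos, every prefix reaching into the second
    half satisfies the ballot inequality iff the complementary suffix does after
    mirroring, so the word is a ballot sequence iff both staircases have the
    prefix property ([ballot_from_mirror]).  A staircase need only be tested
    just after each of its d twos ([ballot_from_stair]), and there the two
    halves give the two inequalities of (i).  Condition (ii) counts the
    letters, since [foata] only rearranges them. *)

(** * Foata's map on words in 1 and 2 *)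

Lemma perm_foata_step w a : perm_eq (foata_step w a) (rcons w a).
Proof.
rewrite /foata_step; set p := (if _ then _ else _).
rewrite -!cats1 perm_cat2r -[X in perm_eq _ X](flatten_factorize p w).
elim: (factorize p w) => //= f fs IH.
by apply: perm_cat => //; rewrite perm_rotr.
Qed.

Lemma perm_foata v : perm_eq (foata v) v.
Proof.
elim/last_ind: v => // v a IH.
rewrite /foata -cats1 foldl_cat /= cats1 (perm_trans (perm_foata_step _ _)) //.
by rewrite -!cats1 perm_cat2r.
Qed.

Lemma rotr_factorize_all (p : pred nat) w :
  all p w -> flatten [seq rotr 1 f | f <- factorize p w] = w.
Proof. by elim: w => //= x w IH /andP[-> /IH /= ->]. Qed.

(** Putting the last letter of each factor in front of it is the same as putting
    the last letter of the previous factor there, since all of them equal [b];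
    so the net effect is to move the final [b] to the front of the word. *)
Lemma rotr_factorize_const (p : pred nat) b u :
    p b -> {in u, forall x, p x -> x = b} ->
  flatten [seq rotr 1 f | f <- factorize p (rcons u b)] = b :: u.
Proof.
move=> pb; elim: u => [|x u IH] hu /=; first by rewrite pb.
have {}IH := IH (fun y hy => hu y (mem_behead (s := x :: u) hy)).
case: ifP => px; first by rewrite /= IH (hu x (mem_head _ _) px).
have: all (marked_factor p) (factorize p (rcons u b)).
  by case: u {hu IH} => [|y u]; apply: factorize_marked; rewrite ?last_rcons.
case: (factorize p _) IH => [//|f fs] /= IH /andP[+ _].
case/lastP: f IH => // g c.
by rewrite -rcons_cons !rotr1_rcons /= => -[-> ->].
Qed.

Lemma foata_step2 w : word12 w -> foata_step w 2 = rcons w 2.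
Proof.
move=> hw; rewrite /foata_step.
have le2 : all (fun x => x <= 2) w.
  by apply: sub_all hw => x /orP[] /eqP->.
have -> : last 2 w <= 2.
  by case/lastP: w le2 {hw} => // w b; rewrite all_rcons last_rcons => /andP[].
by rewrite rotr_factorize_all.
Qed.

Lemma foata_step1 u b :
  word12 (rcons u b) -> foata_step (rcons u b) 1 = rcons (b :: u) 1.
Proof.
rewrite /word12 all_rcons => /andP[hb /allP hu]; rewrite /foata_step last_rcons.
rewrite rotr_factorize_const //; case/orP: hb => /eqP-> //= x /hu.
  by case/orP=> /eqP->.
by case/orP=> /eqP->.
Qed.

Lemma word12_nseq c x : word12 [:: x] -> word12 (nseq c x).
Proof. by rewrite /word12 all_seq1 all_nseq => ->; rewrite orbT. Qed.

Lemma word12_cat s t : word12 (s ++ t) = word12 s && word12 t.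
Proof. exact: all_cat. Qed.

Lemma word12_rcons s x : word12 (rcons s x) = word12 [:: x] && word12 s.
Proof. by rewrite /word12 all_rcons /= andbT. Qed.

Lemma foldl_foata_step2 c w :
  word12 w -> foldl foata_step w (nseq c 2) = w ++ nseq c 2.
Proof.
elim: c w => [|c IH] w hw /=; first by rewrite cats0.
by rewrite foata_step2 // IH ?word12_rcons // cat_rcons.
Qed.

Lemma foldl_foata_step1 c u : word12 u ->
  foldl foata_step (rcons u 1) (nseq c 1) = nseq c 1 ++ rcons u 1.
Proof.
elim: c u => //= c IH u hu.
rewrite foata_step1; last by rewrite word12_rcons hu.
rewrite IH //.
by rewrite rcons_cons -cat_rcons -cats1 -(nseqD c 1) addn1.
Qed.

(** * The closed form *)

(** 1^(a d) 2 1^(a (d-1)) 2 ... 2 1^(a 0) *)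
Fixpoint stair (a : nat -> nat) (d : nat) : seq nat :=
  nseq (a d) 1 ++ if d is e.+1 then 2 :: stair a e else [::].

(** Subtraction from 3 exchanges the letters 1 and 2. *)
Definition mirror (w : seq nat) : seq nat := rev [seq 3 - x | x <- w].

Lemma mirror_cat s t : mirror (s ++ t) = mirror t ++ mirror s.
Proof. by rewrite /mirror map_cat rev_cat. Qed.

Lemma mirror_cons x s : mirror (x :: s) = rcons (mirror s) (3 - x).
Proof. by rewrite /mirror /= rev_cons. Qed.

Lemma mirror_nseq1 c : mirror (nseq c 1) = nseq c 2.
Proof. by rewrite /mirror map_nseq rev_nseq. Qed.

Lemma word12_stair a d : word12 (stair a d).
Proof.
by elim: d => [|d IH] /=; rewrite word12_cat word12_nseq.
Qed.

Lemma word12_mirror w : word12 w -> word12 (mirror w).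
Proof.
rewrite /mirror /word12 all_rev all_map; apply: sub_all => x.
by case/orP=> /eqP->.
Qed.

Lemma eq_stair a b d : (forall i, i <= d -> a i = b i) -> stair a d = stair b d.
Proof.
elim: d => [|d IH] hab /=; first by rewrite hab.
by rewrite hab // IH // => i /leqW/hab.
Qed.

(** Splits off the leading 1 of the top step; in the mirrored half of the closed
    form this is the final 2, which the next descent moves to the front. *)
Lemma stair_top a b d : a d = (b d).+1 -> (forall i, i < d -> a i = b i) ->
  stair a d = 1 :: stair b d.
Proof.
by case: d => [|d] /= -> // hab; rewrite (@eq_stair a b).
Qed.

Definition blocks (m k : nat -> nat) (d : nat) : seq nat :=
  flatten [seq nseq (m i) 1 ++ nseq (k i) 2 | i <- iota 0 d.+1].

Lemma blocksS m k d :
  blocks m k d.+1 = blocks m k d ++ (nseq (m d.+1) 1 ++ nseq (k d.+1) 2).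
Proof.
by rewrite /blocks -[d.+2]addn1 iotaD map_cat flatten_cat /= cats0.
Qed.

Lemma foata_blocks m k d :
    (forall i, 1 <= i <= d -> 0 < m i) -> (forall j, j < d -> 0 < k j) ->
  foata (blocks m k d) =
    stair (fun i => m i - (0 < i)) d ++ mirror (stair (fun i => k i - (i < d)) d).
Proof.
elim: d => [|d IH] hm hk.
  rewrite /blocks /= !subn0 !cats0 mirror_nseq1 /foata foldl_cat.
  have -> : foldl foata_step [::] (nseq (m 0) 1) = nseq (m 0) 1.
    case: (m 0) => // c; have := foldl_foata_step1 c [::] isT.
    by rewrite -[rcons _ _]/(nseq 1 1) -nseqD addn1.
  by rewrite foldl_foata_step2 // word12_nseq.
have {}IH : foata (blocks m k d) = _ :=
  IH (fun i hi => hm i ltac:(lia)) (fun j hj => hk j ltac:(lia)).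
rewrite blocksS /foata 2!foldl_cat -/(foata (blocks m k d)) IH {IH}.
set a := fun i => m i - _.
pose b i := (k i).-1.
have hL : word12 (stair a d) := word12_stair a d.
have hR : word12 (mirror (stair b d)) := word12_mirror _ (word12_stair b d).
have kd := hk d (ltnSn d).
have -> : stair (fun i => k i - (i < d)) d = 1 :: stair b d.
  apply: stair_top => [|i ->]; last by rewrite subn1.
  by rewrite ltnn subn0 /b prednK.
rewrite mirror_cons -rcons_cat.
have -> : nseq (m d.+1) 1 = 1 :: nseq (a d.+1) 1.
  by have := hm d.+1 (ltac:(lia)); rewrite /a; case: (m d.+1) => //= c; rewrite subn1.
rewrite [foldl _ _ (1 :: _)]/= foata_step1 ?word12_rcons ?word12_cat ?hL //.
rewrite foldl_foata_step1 ?foldl_foata_step2 //=; first last.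
- by rewrite word12_cat hL.
- by rewrite word12_cat word12_nseq //= word12_rcons word12_cat hL.
rewrite mirror_cat mirror_cons ltnn subn0 mirror_nseq1.
have -> : stair (fun i => k i - (i < d.+1)) d = stair b d.
  by apply: eq_stair => i; rewrite ltnS => ->; rewrite subn1.
by rewrite -[3 - 1]/2 -[3 - 2]/1 -!cats1 -!catA /= -!catA.
Qed.

(** * The prefix property *)

(** The ballot inequality for words read after a surplus of [h] ones. *)
Definition ballot_from (h : nat) (w : seq nat) : Prop :=
  forall i, count_mem 2 (take i w) <= h + count_mem 1 (take i w).

Lemma ballotE w : ballot w <-> word12 w /\ ballot_from 0 w.
Proof.
split=> -[hw hb]; split=> //; first by move=> i; apply/hb/prefix_take.
by move=> u; rewrite prefixE => /eqP<-; apply: hb.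
Qed.

Lemma ballot_from_nseq1 c h w :
  ballot_from h (nseq c 1 ++ w) <-> ballot_from (h + c) w.
Proof.
elim: c h => [|c IH] h /=; first by rewrite addn0.
rewrite addnS -addSn -IH; split=> hb i.
  by have /= := hb i.+1; rewrite addnA addn1.
case: i => [|i] //=; have /= := hb i; lia.
Qed.

Lemma ballot_from_cons2 h w :
  ballot_from h (2 :: w) <-> 0 < h /\ ballot_from h.-1 w.
Proof.
split=> [hb | [h_gt0 hb] [|i]] //=; last by have /= := hb i; lia.
have h_gt0 : 0 < h by have /= := hb 1; rewrite take0 /=; lia.
by split=> // i; have /= := hb i.+1; lia.
Qed.

(** The surplus of ones only drops at the twos; after the i-th of them it is
    [h] plus the lengths of the top i steps, minus i. *)
Lemma ballot_from_stair a d h :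
  ballot_from h (stair a d) <->
  forall i, 1 <= i <= d -> i <= h + \sum_(0 <= j < i) a (d - j).
Proof.
elim: d h => [|d IH] h /=; rewrite ballot_from_nseq1.
  by split=> [_ i|_ i] //; lia.
rewrite ballot_from_cons2 IH; split=> [[hpos hb] [|i] hi | hb] //.
  rewrite big_nat_recl // subn0.
  under eq_bigr do rewrite subSS.
  case: i hi => [|i] hi; first by rewrite big_geq //; lia.
  by have := hb i.+1 (ltac:(lia)); lia.
split=> [|i hi]; first by have := hb 1 isT; rewrite big_nat1 subn0.
have := hb i.+1 (ltac:(lia)); rewrite big_nat_recl // subn0.
under eq_bigr do rewrite subSS.
lia.
Qed.

Lemma count_mirror1 w : count_mem 1 (mirror w) = count_mem 2 w.
Proof.
by rewrite /mirror count_rev count_map; apply: eq_count => x /=; lia.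
Qed.

Lemma count_mirror2 w : count_mem 2 (mirror w) = count_mem 1 w.
Proof.
by rewrite /mirror count_rev count_map; apply: eq_count => x /=; lia.
Qed.

Lemma take_mirror i w : take i (mirror w) = mirror (drop (size w - i) w).
Proof. by rewrite /mirror take_rev size_map map_drop. Qed.

(** In a balanced word a prefix has at least as many ones as twos iff the
    remaining suffix has at least as many twos as ones, that is, iff the mirror
    image of that suffix, a prefix of [y], satisfies the ballot inequality. *)
Lemma ballot_from_mirror x y :
    count_mem 1 (x ++ mirror y) = count_mem 2 (x ++ mirror y) ->
  ballot_from 0 (x ++ mirror y) <-> ballot_from 0 x /\ ballot_from 0 y.
Proof.
rewrite !count_cat count_mirror1 count_mirror2 => bal.
have cnt c i : count_mem c y = count_mem c (take i y) + count_mem c (drop i y).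
  by rewrite -count_cat cat_take_drop.
split=> [hb | [hx hy] i].
  split=> i.
    case: (leqP i (size x)) => hi; first by have := hb i; rewrite takel_cat.
    by have := hb (size x); rewrite take_size_cat // take_oversize // ltnW.
  have [hi|/ltnW hi] := leqP i (size y); last first.
    have := hb (size x); rewrite take_size_cat // take_oversize //; lia.
  have := hb (size x + (size y - i)).
  rewrite takeD take_size_cat // drop_size_cat // take_mirror subKn //.
  rewrite !count_cat count_mirror1 count_mirror2.
  by have := cnt 1 i; have := cnt 2 i; lia.
rewrite take_cat; case: ltnP => // _.
rewrite take_mirror; set j := size y - _.
rewrite !count_cat count_mirror1 count_mirror2.
by have := cnt 1 j; have := cnt 2 j; have := hy j; lia.
Qed.

(** * Counting letters *)

Lemma perm_word12 n w : word12 w ->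
  perm_eq w (nseq n 1 ++ nseq n 2) <-> count_mem 1 w = n /\ count_mem 2 w = n.
Proof.
move=> hw; split=> [/permP hp | [h1 h2]].
  by rewrite !hp !count_cat !count_nseq /=; lia.
apply/allP=> x; rewrite !mem_cat !mem_nseq => hx.
have {hx} : x \in [:: 1; 2].
  have hw12 := allP hw x; rewrite !inE; case/orP: hx => [/hw12 //|].
  by case/orP=> /andP[_ ->]; rewrite ?orbT.
rewrite !inE /= !count_cat !count_nseq.
by case/orP=> /eqP->; rewrite ?h1 ?h2 /= ?mul1n ?mul0n ?addn0.
Qed.

Lemma count_blocks m k d :
  count_mem 1 (blocks m k d) = \sum_(0 <= i < d.+1) m i /\
  count_mem 2 (blocks m k d) = \sum_(0 <= i < d.+1) k i.
Proof.
elim: d => [|d [IH1 IH2]].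
  by rewrite /blocks /= !big_nat1 !cats0 !count_cat !count_nseq /=; lia.
rewrite blocksS !(big_nat_recr d.+1) //= -IH1 -IH2 !count_cat !count_nseq /=.
lia.
Qed.

Lemma sum_pred_steps m d i :
    (forall i, 1 <= i <= d -> 0 < m i) -> i <= d ->
  \sum_(0 <= j < i) m (d - j) =
  \sum_(0 <= j < i) (m (d - j) - (0 < d - j)) + i.
Proof.
move=> hm; elim: i => [|i IH] hi; first by rewrite !big_geq.
rewrite !big_nat_recr //= IH ?(ltnW hi) //.
have := hm (d - i) (ltac:(lia)); lia.
Qed.

(** The top step keeps its full length, so only i - 1 of the i steps lose a
    letter; this is where the bound 2i - 1, rather than 2i, comes from. *)
Lemma sum_pred_lower_steps k d i :
    (forall j, j < d -> 0 < k j) -> 0 < i <= d ->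
  (\sum_(0 <= j < i) k (d - j)).+1 =
  \sum_(0 <= j < i) (k (d - j) - (d - j < d)) + i.
Proof.
move=> hk; elim: i => [//|[|i] IH] hi.
  by rewrite !big_nat1 subn0 ltnn; lia.
rewrite !(big_nat_recr i.+1) //= -addSn IH; last by lia.
have := hk (d - i.+1) (ltac:(lia)); lia.
Qed.

(** * The characterization *)

Theorem theorem3p3 (v : seq nat) (d : nat) (m k : nat -> nat) (n : nat)
    (hv : word12 v)
    (hd : descents v = d)
    (hm : forall i, 1 <= i <= d -> 0 < m i)
    (hk : forall j, j < d -> 0 < k j)
    (hvE : v = flatten [seq nseq (m i) 1 ++ nseq (k i) 2 | i <- iota 0 d.+1]) :
  in_B n (foata v) <->
    (forall i, 1 <= i <= d ->
       2 * i <= \sum_(0 <= j < i) m (d - j) /\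
       2 * i - 1 <= \sum_(0 <= j < i) k (d - j)) /\
    (\sum_(0 <= i < d.+1) m i = \sum_(0 <= i < d.+1) k i /\
     \sum_(0 <= i < d.+1) k i = n).
Proof.
have hw : word12 (foata v) by rewrite /word12 (perm_all _ (perm_foata v)).
rewrite /in_B ballotE perm_word12 //.
have [c1 c2] := count_blocks m k d; rewrite -/(blocks m k d) in hvE.
have /permP hp := perm_foata v.
have {c1}c1 : count_mem 1 (foata v) = \sum_(0 <= i < d.+1) m i.
  by rewrite hp hvE.
have {c2}c2 : count_mem 2 (foata v) = \sum_(0 <= i < d.+1) k i.
  by rewrite hp hvE.
have ballotP : count_mem 1 (foata v) = count_mem 2 (foata v) ->
    ballot_from 0 (foata v) <-> forall i, 1 <= i <= d ->
       2 * i <= \sum_(0 <= j < i) m (d - j) /\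
       2 * i - 1 <= \sum_(0 <= j < i) k (d - j).
  rewrite hvE foata_blocks // => bal.
  rewrite ballot_from_mirror // !ballot_from_stair.
  split=> [[hx hy] i hi | hb].
    have := hx i hi; have := hy i hi.
    have := sum_pred_steps m d i hm; have := sum_pred_lower_steps k d i hk hi.
    lia.
  split=> i hi; have := hb i hi.
    by have := sum_pred_steps m d i hm; lia.
  by have := sum_pred_lower_steps k d i hk hi; lia.
rewrite c1 c2 in ballotP *.
split=> [[[_ hb] [e1 e2]] | [hi [e1 e2]]].
  by split; [apply/ballotP; rewrite ?e1 | rewrite e1].
by split; [split=> //; apply/ballotP | rewrite e1].
Qed.
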